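(* Let $\mathbb{F}$ be a field, let $\mathbb{V}$ be an $n$-dimensional vector space over $\mathbb{F}$ ($n\ge 1$) with basis $b_1,\dots,b_n$, and let each of the forms $f,g,h$ be either identically zero or the corresponding standard form described in the context. If $f$, $g$ and $h$ are all identically zero, then the ternary algebra $\mathcal{V}_{0,0,0}$ is a ternary Jordan algebra. If at least one of $f,g,h$ is not identically zero, then $\mathcal{V}_{f,g,h}$ is not a ternary Jordan algebra, with exactly the following exceptions, in which it is a ternary Jordan algebra (a letter $f$, $g$, $h$ in the subscript denotes a nonzero form, and $0$ denotes the zero form): \begin{itemize} \item $\mathcal{V}_{0,0,h}$, if $\mathrm{char}(\mathbb{F})=3$ and $\dim\mathbb{V}=1$; \item $\mathcal{V}_{0,g,0}$, if $\mathrm{char}(\mathbb{F})=2$ and $\dim\mathbb{V}=1$; \item $\mathcal{V}_{f,0,h}$, if $\mathrm{char}(\mathbb{F})=2$ (any dimension of $\mathbb{V}$); \item $\mathcal{V}_{f,g,h}$, if $\mathrm{char}(\mathbb{F})=2$ and $\dim\mathbb{V}=1$. \end{itemize}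
   Context: Standard forms on $\mathbb{V}$ relative to the basis $b_1,\dots,b_n$: $f$ and $h$ are the symmetric bilinear forms with $f(b_i,b_j)=\delta_{ij}$ and $h(b_i,b_j)=\delta_{ij}$; $g$ is the symmetric trilinear form with $g(b_i,b_j,b_k)=\delta_{ijk}$ (equal to $1$ if $i=j=k$ and $0$ otherwise). The ternary algebra $\mathcal{V}_{f,g,h}$ is the vector space $\mathbb{F}\oplus\mathbb{V}$ with the trilinear product, for $\alpha_i\in\mathbb{F}$, $v_i\in\mathbb{V}$, $$[\alpha_1+v_1,\alpha_2+v_2,\alpha_3+v_3]=\big(\alpha_1\alpha_2\alpha_3+\alpha_1 f(v_2,v_3)+\alpha_2 f(v_1,v_3)+\alpha_3 f(v_1,v_2)+g(v_1,v_2,v_3)\big)+(\alpha_2\alpha_3+h(v_2,v_3))v_1+(\alpha_1\alpha_3+h(v_1,v_3))v_2+(\alpha_1\alpha_2+h(v_1,v_2))v_3 .$$ A ternary algebra with product $[\cdot,\cdot,\cdot]$ is a ternary Jordan algebra if (i) the product is totally commutative, i.e. $[x_{\sigma(1)},x_{\sigma(2)},x_{\sigma(3)}]=[x_1,x_2,x_3]$ for all permutations $\sigma\in S_3$; and (ii) for all pairs $x=(x_1,x_2)$, $y=(y_1,y_2)$ of elements, the linear map $D_{x,y}(z)=[[z,x_1,x_2],y_1,y_2]-[[z,y_1,y_2],x_1,x_2]$ is a derivation: $D_{x,y}[z_1,z_2,z_3]=[D_{x,y}(z_1),z_2,z_3]+[z_1,D_{x,y}(z_2),z_3]+[z_1,z_2,D_{x,y}(z_3)]$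 for all $z_1,z_2,z_3$. *)

(* Defs.v *)
From HB Require Import structures.
From mathcomp Require Import all_boot all_fingroup all_algebra.
From mathcomp Require Import ring.

Set Implicit Arguments.
Unset Strict Implicit.
Unset Printing Implicit Defensive.

Import GRing.Theory.

Local Open Scope ring_scope.

Definition trilinear (F : fieldType) (U W : lmodType F) (p : U -> U -> U -> W) :=
  [/\ forall y z, linear (fun x => p x y z),
      forall x z, linear (fun y => p x y z) &
      forall x y, linear (fun z => p x y z)].

Record trilinear_map (F : fieldType) (U W : lmodType F) := TrilinearMap {
  trilinear_fun :> U -> U -> U -> W;
  trilinear_funP : trilinear trilinear_fun
}.

(* 0, 1 and 2 are the three elements of 'I_3. *)
Definition totally_symmetric (U W : Type) (p : U -> U -> U -> W) :=
  forall (s : 'S_3) (x : 'I_3 -> U),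
    p (x (s 0)) (x (s 1)) (x (s 2)) = p (x 0) (x 1) (x 2).

Definition ternary_algebra (F : fieldType) (A : lmodType F) :=
  trilinear_map A A.

Section TernaryJordan.
Variables (F : fieldType) (A : lmodType F) (p : ternary_algebra A).

Definition is_derivation (D : {linear A -> A}) :=
  forall z1 z2 z3,
    D (p z1 z2 z3) = p (D z1) z2 z3 + p z1 (D z2) z3 + p z1 z2 (D z3).

Definition Dmap (x y : A * A) (z : A) : A :=
  p (p z x.1 x.2) y.1 y.2 - p (p z y.1 y.2) x.1 x.2.

Lemma Dmap_is_linear x y : linear (Dmap x y).
Proof.
case: (trilinear_funP p) => lin1 _ _ a u v; rewrite /Dmap.
have pl k w c d : p (a *: k + w) c d = a *: p k c d + p w c d.
  exact: (lin1 c d a k w).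
by rewrite !pl scalerBr opprD addrACA.
Qed.

HB.instance Definition _ x y :=
  GRing.isLinear.Build F A A _ (Dmap x y) (Dmap_is_linear x y).

Definition ternary_Jordan :=
  totally_symmetric p /\ forall x y : A * A, is_derivation (Dmap x y).

End TernaryJordan.

Section AlgebraOfForms.
Variables (F : fieldType) (V : vectType F).
Variables (f : {symmetric V}) (g : trilinear_map V F^o) (h : {symmetric V}).

(* The pair (a, v) stands for the element a + v of F (+) V. *)
Definition Vfgh_prod (x1 x2 x3 : F^o * V) : F^o * V :=
  let: (a1, v1) := x1 in let: (a2, v2) := x2 in let: (a3, v3) := x3 in
  (a1 * a2 * a3 + a1 * f v2 v3 + a2 * f v1 v3 + a3 * f v1 v2 + g v1 v2 v3,
   (a2 * a3 + h v2 v3) *: v1 + (a1 * a3 + h v1 v3) *: v2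
     + (a1 * a2 + h v1 v2) *: v3).

Lemma form_linearl (e : {symmetric V}) k u v w :
  e (k *: u + v) w = k * e u w + e v w.
Proof. exact: linearPl. Qed.

Lemma form_linearr (e : {symmetric V}) k u v w :
  e w (k *: u + v) = k * e w u + e w v.
Proof. exact: linearPr. Qed.

Lemma comb_linear (k c d d' e e' : F) (u v w1 w2 : V) :
  c *: (k *: u + v) + (k * d + d') *: w1 + (k * e + e') *: w2 =
  k *: (c *: u + d *: w1 + e *: w2) + (c *: v + d' *: w1 + e' *: w2).
Proof.
rewrite !scalerDr !scalerDl !scalerA (mulrC c k).
by rewrite (addrACA (_ *: u)) (addrACA (_ + _)).
Qed.

Lemma comb_linear2 (k c d d' e e' : F) (u v w1 w2 : V) :
  (k * d + d') *: w1 + c *: (k *: u + v) + (k * e + e') *: w2 =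
  k *: (d *: w1 + c *: u + e *: w2) + (d' *: w1 + c *: v + e' *: w2).
Proof.
by rewrite [X in X + _]addrC comb_linear (addrC (d *: w1)) (addrC (d' *: w1)).
Qed.

Lemma comb_linear3 (k c d d' e e' : F) (u v w1 w2 : V) :
  (k * d + d') *: w1 + (k * e + e') *: w2 + c *: (k *: u + v) =
  k *: (d *: w1 + e *: w2 + c *: u) + (d' *: w1 + e' *: w2 + c *: v).
Proof.
by rewrite addrC addrA comb_linear (addrC _ (c *: u)) (addrC _ (c *: v)) !addrA.
Qed.

Lemma Vfgh_prod_trilinear : trilinear Vfgh_prod.
Proof.
have [lin1 lin2 lin3] := trilinear_funP g.
have gl1 k u v y z : g (k *: u + v) y z = k * g u y z + g v y z.
  exact: (lin1 y z k u v).
have gl2 k u v y z : g y (k *: u + v) z = k * g y u z + g y v z.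
  exact: (lin2 y z k u v).
have gl3 k u v y z : g y z (k *: u + v) = k * g y z u + g y z v.
  exact: (lin3 y z k u v).
split=> [[a2 v2] [a3 v3]|[a1 v1] [a3 v3]|[a1 v1] [a2 v2]] k [a u] [c v].
- congr pair.
    rewrite /= !form_linearl gl1 /GRing.scale /=; ring.
  rewrite /= !form_linearl -comb_linear /GRing.scale /=.
  by congr (_ + _ *: _ + _ *: _); ring.
- congr pair.
    rewrite /= form_linearl form_linearr gl2 /GRing.scale /=; ring.
  rewrite /= form_linearl form_linearr -comb_linear2.
  by congr (_ *: _ + _ + _ *: _); rewrite /GRing.scale /=; ring.
- congr pair.
    rewrite /= !form_linearr gl3 /GRing.scale /=; ring.
  rewrite /= !form_linearr -comb_linear3.
  by congr (_ *: _ + _ *: _ + _); rewrite /GRing.scale /=; ring.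
Qed.

Definition Vfgh : ternary_algebra (F^o * V)%type :=
  TrilinearMap Vfgh_prod_trilinear.

End AlgebraOfForms.

Section Standard.
Variables (F : fieldType) (V : vectType F) (n : nat) (b : n.-tuple V).

Definition standard_bilinear (f : {symmetric V}) :=
  forall i j : 'I_n, f (tnth b i) (tnth b j) = (i == j)%:R.

Definition standard_trilinear (g : trilinear_map V F^o) :=
  totally_symmetric g /\
  forall i j k : 'I_n,
    g (tnth b i) (tnth b j) (tnth b k) = ((i == j) && (j == k))%:R.

End Standard.

Definition zero_bilinear (F : fieldType) (V : vectType F) (f : {symmetric V}) :=
  forall v w : V, f v w = 0.

Definition zero_trilinear (F : fieldType) (V : vectType F)
    (g : trilinear_map V F^o) :=
  forall u v w : V, g u v w = 0.

(* Main.v *)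
Require Import Defs.
From HB Require Import structures.
From mathcomp Require Import all_boot all_fingroup all_algebra.
From mathcomp Require Import ring.

Set Implicit Arguments.
Unset Strict Implicit.
Unset Printing Implicit Defensive.

Import GRing.Theory.

(** The tests for the forms being zero or standard are encoded by weights
    phi, gamma, eta in {0, 1}: in the basis b, f is phi times, g is gamma times
    and h is eta times the standard form.  Writing R_x for the map
    z |-> [z, x1, x2], the map D_{x,y} is the commutator of R_y and R_x.

    A Jordan algebra imposes equations on the weights.  The element 1 and one
    basis vector u span a subalgebra in which D_{(u,u),(1,u)} is a 2 x 2
    matrix, and testing the derivation rule on 1 and u gives
      2 gamma = 0,  6 eta = 2 phi,  gamma (phi - 9 eta) = 0,
      3 (3 eta - phi) (eta - phi) = 0.
    If there is a second basis vector w, then D_{(u,u),(1,u)} tested on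
    (w, w, w) and D_{(u,w),(1,u)} tested on (1, u, u) give moreover
      gamma^2 = 0,  eta (eta - phi) = 0
    (Jordan_line_conditions, Jordan_plane_conditions).  Among weights in
    {0, 1}, only the listed exceptions solve these equations
    (weights_classification).

    Conversely, each remaining algebra has one of three shapes.
    - For zero forms, the product is the triple product of the commutative
      associative algebra F (+) V in which V V = 0, so D = 0.  In
      characteristic 3 and dimension 1 the form h contributes only
      3 eta v1 v2 v3 = 0 and leaves this same product.
    - For f = h and g = 0 in characteristic 2, the identity 1 = 3 turns the
      product into B(y,z) x + B(x,z) y + B(x,y) z, where B is the symmetric
      form 1 (+) h.  The maps R_x are then self-adjoint for B, so D is
      skew, and the skew maps of B are derivations of that product.
    - In dimension 1 and characteristic 2 with equal weights for f and h, the
      2 x 2 matrices of the maps R_x have the form [[s, t], [q, s]], so their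
      commutators are scalar; a scalar map c satisfies the derivation rule
      because c = 3 c. *)

Local Open Scope ring_scope.

(** * Trilinear maps and symmetry *)

Section TrilinearMaps.
Variables (F : fieldType) (U W : lmodType F) (p : trilinear_map U W).

Lemma trilinear_comb1 k l u v y z :
  p (k *: u + l *: v) y z = k *: p u y z + l *: p v y z.
Proof.
have [lin _ _] := trilinear_funP p.
have p0 : p 0 y z = 0.
  by have := lin y z (-1) 0 0; rewrite scaler0 addr0 scaleN1r addNr.
rewrite [LHS](lin y z); congr (_ + _).
by have := lin y z l v 0; rewrite p0 !addr0.
Qed.

Lemma trilinear_comb2 k l u v y z :
  p y (k *: u + l *: v) z = k *: p y u z + l *: p y v z.
Proof.
have [_ lin _] := trilinear_funP p.
have p0 : p y 0 z = 0.
  by have := lin y z (-1) 0 0; rewrite scaler0 addr0 scaleN1r addNr.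
rewrite [LHS](lin y z); congr (_ + _).
by have := lin y z l v 0; rewrite p0 !addr0.
Qed.

Lemma trilinear_comb3 k l u v y z :
  p y z (k *: u + l *: v) = k *: p y z u + l *: p y z v.
Proof.
have [_ _ lin] := trilinear_funP p.
have p0 : p y z 0 = 0.
  by have := lin y z (-1) 0 0; rewrite scaler0 addr0 scaleN1r addNr.
rewrite [LHS](lin y z); congr (_ + _).
by have := lin y z l v 0; rewrite p0 !addr0.
Qed.

Definition trilinear_combE :=
  (trilinear_comb1, trilinear_comb2, trilinear_comb3).

Lemma trilinearZ1 k u y z : p (k *: u) y z = k *: p u y z.
Proof.
by have := trilinear_comb1 k 0 u u y z; rewrite !scale0r !addr0.
Qed.

End TrilinearMaps.

Lemma totally_symmetric_swaps (U W : Type) (p : U -> U -> U -> W) :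
  (forall x y z, p x y z = p y x z) -> (forall x y z, p x y z = p x z y) ->
  totally_symmetric p.
Proof.
move=> p12 p23 s x.
have neq i j : i != j -> s i != s j by apply: contraNN => /eqP/perm_inj ->.
have := neq 0 1 isT; have := neq 0 2 isT; have := neq 1 2 isT.
have ord3 (i : 'I_3) : [\/ i = 0, i = 1 | i = 2].
  case: i => [[|[|[|//]]] ilt]; [constructor 1|constructor 2|constructor 3];
    exact: val_inj.
case: (ord3 (s 0)) => ->; case: (ord3 (s 1)) => ->;
  case: (ord3 (s 2)) => ->; rewrite ?eqxx //= => _ _ _.
- by rewrite p23 p12.
- by rewrite p12 p23.
- by rewrite p12 p23 p12.
Qed.

(** * Criteria for ternary Jordan algebras *)

Section TernaryJordan.
Variables (F : fieldType) (A : lmodType F) (p : ternary_algebra A).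

(** The derivation rule for a scalar map c is c p = 3 c p, so the scalars
    annihilated by 2 are derivations. *)
Lemma ternary_Jordan_scalar :
  (forall x y z, p x y z = p y x z) -> (forall x y z, p x y z = p x z y) ->
  (forall x y : A * A, exists2 c, c + c = 0 & forall z, Dmap p x y z = c *: z) ->
  ternary_Jordan p.
Proof.
move=> p12 p23 Dscalar.
split=> [|x y z1 z2 z3]; first exact: totally_symmetric_swaps.
have [c c2 Dc] := Dscalar x y; rewrite /= !Dc.
rewrite [p z1 (_ *: _) _]p12 [p z1 _ (_ *: _)]p23 [p z1 (_ *: _) _]p12.
rewrite !trilinearZ1 [p z2 _ _]p12 [p z3 _ _]p12 [p z1 z3 _]p23.
by rewrite -!scalerDl -addrA c2 addr0.
Qed.

(** Multiplications by pairs are self-adjoint for B, their commutators are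
    skew, and a skew map is a derivation of every product built from B alone. *)
Lemma ternary_Jordan_symmetric_form (B : A -> A -> F) :
  (forall x y, B x y = B y x) ->
  (forall z k x y, B (k *: x + y) z = k * B x z + B y z) ->
  (forall x y z, p x y z = B y z *: x + B x z *: y + B x y *: z) ->
  ternary_Jordan p.
Proof.
move=> Bsym Blin pE.
have BD x y z : B (x + y) z = B x z + B y z.
  by rewrite -[x]scale1r Blin mul1r scale1r.
have B0 z : B 0 z = 0 by apply: (addrI (B 0 z)); rewrite -BD !addr0.
have BZ k x z : B (k *: x) z = k * B x z by rewrite -[k *: x]addr0 Blin B0 addr0.
have p12 x y z : p x y z = p y x z by rewrite !pE (addrC (B x z *: y)) (Bsym x y).
have p23 x y z : p x y z = p x z y by rewrite !pE addrAC (Bsym y z).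
split=> [|x y z1 z2 z3]; first exact: totally_symmetric_swaps.
have BN u v : B (- u) v = - B u v by rewrite -scaleN1r BZ mulN1r.
have adj u1 u2 z w : B (p z u1 u2) w = B z (p w u1 u2).
  rewrite [RHS]Bsym !pE !BD !BZ (Bsym w z) (Bsym w u1) (Bsym w u2).
  by rewrite (Bsym z u1) (Bsym z u2); ring.
pose D := Dmap p x y.
have skew z w : B (D z) w + B z (D w) = 0.
  rewrite (Bsym z) /D /Dmap !BD !BN !adj.
  by rewrite !(Bsym w) !adj; ring.
have DD u v : D (u + v) = D u + D v := raddfD (Dmap p x y) u v.
have DZ k u : D (k *: u) = k *: D u := linearZ_LR (Dmap p x y) k u.
change (D (p z1 z2 z3) =
  p (D z1) z2 z3 + p z1 (D z2) z3 + p z1 z2 (D z3)).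
rewrite !pE !DD !DZ.
have cancel u v : B u (D v) = - B (D u) v.
  by apply: (addrI (B (D u) v)); rewrite skew subrr.
rewrite !cancel !scaleNr.
(* The six terms that involve B (D _) _ now cancel in pairs. *)
set a := _ *: D z1; set b := _ *: D z2; set c := _ *: D z3.
set u := B (D z1) z3 *: z2; set v := B (D z1) z2 *: z3.
set w := B (D z2) z3 *: z1.
rewrite (addrA (a + u + v)) (addrAC (a + u)) addrK addrA; congr (_ + c).
by rewrite -opprD (addrC w b) addrACA (addrC w u) addrK.
Qed.

Section Subalgebra.
Variables (B : zmodType) (m : B -> B -> B -> B) (e : {additive B -> A}).

(** D_{x,y}, for a product m that is not packaged as a trilinear map. *)
Definition mul_commutator (x y : B * B) z :=
  m (m z x.1 x.2) y.1 y.2 - m (m z y.1 y.2) x.1 x.2.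

Hypothesis em : forall x y z, p (e x) (e y) (e z) = e (m x y z).

Lemma Dmap_sub x y z :
  Dmap p (e x.1, e x.2) (e y.1, e y.2) (e z) = e (mul_commutator x y z).
Proof. by rewrite /Dmap /= !em -raddfB. Qed.

(** The derivation rule passes to subalgebras, where it can be evaluated in
    coordinates. *)
Lemma Jordan_sub x y z1 z2 z3 : injective e -> ternary_Jordan p ->
  mul_commutator x y (m z1 z2 z3) =
  m (mul_commutator x y z1) z2 z3 + m z1 (mul_commutator x y z2) z3
  + m z1 z2 (mul_commutator x y z3).
Proof.
move=> inj_e [_ derp]; apply: inj_e.
have := derp (e x.1, e x.2) (e y.1, e y.2) (e z1) (e z2) (e z3).
by rewrite /= !em !Dmap_sub !em -!raddfD.
Qed.

End Subalgebra.

End TernaryJordan.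

(** * Products with zero forms *)

Section DualNumbers.
Variables (F : fieldType) (V : vectType F).
Variable p : ternary_algebra (F^o * V)%type.
Hypothesis pE : forall x y z, p x y z =
  (x.1 * y.1 * z.1,
   (y.1 * z.1) *: x.2 + (x.1 * z.1) *: y.2 + (x.1 * y.1) *: z.2).

(** This is the triple product of a commutative associative algebra, the
    trivial square-zero extension of F by V, so multiplications commute and
    D = 0. *)
Lemma ternary_Jordan_dual_numbers : ternary_Jordan p.
Proof.
apply: ternary_Jordan_scalar => [x y z|x y z|x y].
- rewrite !pE; congr pair; first by rewrite (mulrC x.1).
  by rewrite (addrC (_ *: x.2)) (mulrC y.1 x.1).
- rewrite !pE; congr pair; first by rewrite mulrAC.
  by rewrite addrAC (mulrC y.1 z.1).
exists 0 => [|z]; first exact: addr0.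
rewrite scale0r /Dmap !pE /=; apply/eqP; rewrite subr_eq0; apply/eqP.
congr pair; first by ring.
rewrite !scalerDr !scalerA -!addrA.
congr (_ *: _ + _); first by ring.
rewrite !addrA -[LHS]addrA [LHS]addrC addrA.
by congr (_ *: _ + _ *: _ + _ *: _ + _ *: _); ring.
Qed.

End DualNumbers.

(** * Subalgebras spanned by 1 and at most two basis vectors *)

Lemma bilinear_comb (F : fieldType) (V : vectType F) (f : {symmetric V})
    a b c d u v u' v' :
  f (a *: u + b *: v) (c *: u' + d *: v') =
  a * c * f u u' + a * d * f u v' + b * c * f v u' + b * d * f v v'.
Proof.
by rewrite form_linearl !form_linearr !linearZl_LR !linearZr_LR /=; ring.
Qed.

Section Embeddings.
Variables (F : fieldType) (V : vectType F).

Definition line_embed (u : V) (x : F^o * F^o) : F^o * V := (x.1, x.2 *: u).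

Lemma line_embed_is_additive u : zmod_morphism (line_embed u).
Proof. by move=> x y; rewrite /line_embed /= scalerBl. Qed.

HB.instance Definition _ u :=
  GRing.isZmodMorphism.Build (F^o * F^o)%type (F^o * V)%type (line_embed u)
    (line_embed_is_additive u).

Definition plane_embed (u w : V) (x : F^o * (F^o * F^o)) : F^o * V :=
  (x.1, x.2.1 *: u + x.2.2 *: w).

Lemma plane_embed_is_additive u w : zmod_morphism (plane_embed u w).
Proof.
move=> x y; rewrite /plane_embed /= !scalerBl; congr pair.
by rewrite /= opprD addrACA.
Qed.

HB.instance Definition _ u w :=
  GRing.isZmodMorphism.Build (F^o * (F^o * F^o))%type (F^o * V)%type
    (plane_embed u w) (plane_embed_is_additive u w).

End Embeddings.

Section CoordinateProducts.
Variables (F : fieldType) (phi gamma eta : F).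

(** The factor 3 appears because the three terms with h coincide on a line. *)
Definition line_prod (x y z : F^o * F^o) : F^o * F^o :=
  (x.1 * y.1 * z.1
     + phi * (x.1 * y.2 * z.2 + y.1 * x.2 * z.2 + z.1 * x.2 * y.2)
     + gamma * (x.2 * y.2 * z.2),
   y.1 * z.1 * x.2 + x.1 * z.1 * y.2 + x.1 * y.1 * z.2
     + 3 * eta * (x.2 * y.2 * z.2)).

Definition dot (v w : F^o * F^o) : F := v.1 * w.1 + v.2 * w.2.

Definition plane_prod (x y z : F^o * (F^o * F^o)) : F^o * (F^o * F^o) :=
  let a := y.1 * z.1 + eta * dot y.2 z.2 in
  let b := x.1 * z.1 + eta * dot x.2 z.2 in
  let c := x.1 * y.1 + eta * dot x.2 y.2 in
  (x.1 * y.1 * z.1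
     + phi * (x.1 * dot y.2 z.2 + y.1 * dot x.2 z.2 + z.1 * dot x.2 y.2)
     + gamma * (x.2.1 * y.2.1 * z.2.1 + x.2.2 * y.2.2 * z.2.2),
   (a * x.2.1 + b * y.2.1 + c * z.2.1, a * x.2.2 + b * y.2.2 + c * z.2.2)).

Variables (V : vectType F) (n : nat) (b : n.-tuple V).
Variables (f : {symmetric V}) (g : trilinear_map V F^o) (h : {symmetric V}).
Hypothesis f_diag :
  forall i j, f (tnth b i) (tnth b j) = phi * (i == j)%:R.
Hypothesis g_diag : forall i j k,
  g (tnth b i) (tnth b j) (tnth b k) = gamma * ((i == j) && (j == k))%:R.
Hypothesis h_diag :
  forall i j, h (tnth b i) (tnth b j) = eta * (i == j)%:R.

Lemma line_prodE i (e := line_embed (tnth b i)) x y z :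
  Vfgh f g h (e x) (e y) (e z) = e (line_prod x y z).
Proof.
set u := tnth b i in e *.
have f1 c d : f (c *: u) (d *: u) = phi * (c * d).
  by rewrite linearZl_LR linearZr_LR /= f_diag eqxx mulr1; ring.
have h1 c d : h (c *: u) (d *: u) = eta * (c * d).
  by rewrite linearZl_LR linearZr_LR /= h_diag eqxx mulr1; ring.
have g1 c d k : g (c *: u) (d *: u) (k *: u) = gamma * (c * d * k).
  have u0 a : a *: u = a *: u + 0 *: u by rewrite scale0r addr0.
  rewrite (u0 c) (u0 d) (u0 k) !trilinear_combE g_diag !eqxx.
  by rewrite /GRing.scale /=; ring.
rewrite /= /line_embed /= !f1 !h1 g1 !scalerA -!scalerDl.
by congr (_, _ *: _); rewrite /line_prod /=; ring.
Qed.

Lemma plane_prodE i j (e := plane_embed (tnth b i) (tnth b j)) x y z :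
  i != j -> Vfgh f g h (e x) (e y) (e z) = e (plane_prod x y z).
Proof.
move=> neq_ij; have neq_ji : j != i by rewrite eq_sym.
set u := tnth b i in e *; set w := tnth b j in e *.
have f2 a c a' c' :
    f (a *: u + c *: w) (a' *: u + c' *: w) = phi * (a * a' + c * c').
  by rewrite bilinear_comb !f_diag !eqxx (negPf neq_ij) (negPf neq_ji) /=; ring.
have h2 a c a' c' :
    h (a *: u + c *: w) (a' *: u + c' *: w) = eta * (a * a' + c * c').
  by rewrite bilinear_comb !h_diag !eqxx (negPf neq_ij) (negPf neq_ji) /=; ring.
have g2 a c a' c' a2 c2 :
    g (a *: u + c *: w) (a' *: u + c' *: w) (a2 *: u + c2 *: w) =
    gamma * (a * a' * a2 + c * c' * c2).
  rewrite !trilinear_combE !g_diag !eqxx (negPf neq_ij) (negPf neq_ji).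
  by rewrite /GRing.scale /=; ring.
rewrite /= /plane_embed /= !f2 !h2 g2; congr pair.
  by rewrite /plane_prod /dot /=; ring.
by rewrite !scalerDr !scalerA [X in X + _ = _]addrACA [LHS]addrACA -!scalerDl.
Qed.

Lemma line_embed_inj i : free b -> injective (line_embed (tnth b i)).
Proof.
move=> free_b [a c] [a' c'] [-> /(congr1 (coord b i))].
rewrite !linearZ /= (tnth_nth 0) coord_free // eqxx.
by rewrite /GRing.scale /= !mulr1 => ->.
Qed.

Lemma plane_embed_inj i j : free b -> i != j ->
  injective (plane_embed (tnth b i) (tnth b j)).
Proof.
move=> free_b neq_ij [a [c d]] [a' [c' d']] [-> E].
have neq_ji : j != i by rewrite eq_sym.
have := congr1 (coord b i) E; have := congr1 (coord b j) E.
rewrite !linearD !linearZ /= !(tnth_nth 0) !coord_free // !eqxx.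
rewrite (negPf neq_ij) (negPf neq_ji) /GRing.scale /=.
by rewrite !mulr1 !mulr0 !add0r !addr0 => -> ->.
Qed.

(** The four equations are components of the derivation rule for D_{(u,u),(1,u)}
    on (1,1,1), (1,1,1), (u,u,u) and (1,u,u). *)
Lemma Jordan_line_conditions (i : 'I_n) : free b -> ternary_Jordan (Vfgh f g h) ->
  [/\ 2 * gamma = 0, 6 * eta = 2 * phi, gamma * (phi - 9 * eta) = 0
    & 3 * (3 * eta - phi) * (eta - phi) = 0].
Proof.
move=> /(@line_embed_inj i) inj_e jordan.
pose o : F^o * F^o := (1, 0); pose u : F^o * F^o := (0, 1).
have rule z1 z2 z3 :=
  @Jordan_sub _ _ _ _ _ _ (@line_prodE i) (u, u) (o, u) z1 z2 z3 inj_e jordan.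
have D z : mul_commutator line_prod (u, u) (o, u) z =
    (phi * (3 * eta - phi) * z.2 - gamma * z.1,
     (phi - 3 * eta) * z.1 + gamma * z.2).
  by congr (_, _); rewrite /=; ring.
have eq0 (a c : F) : a = c -> a - c = 0 by move->; rewrite subrr.
split.
- have := rule o o o; rewrite !D => /(congr1 fst)/eq0 <-.
  by rewrite /=; ring.
- apply/eqP; rewrite -subr_eq0; apply/eqP.
  have := rule o o o; rewrite !D => /(congr1 snd)/eq0 <-.
  by rewrite /=; ring.
- have := rule u u u; rewrite !D => /(congr1 snd)/eq0 <-.
  by rewrite /=; ring.
- have := rule o u u; rewrite !D => /(congr1 snd)/eq0 <-.
  by rewrite /=; ring.
Qed.

(** Since D_{(u,u),(1,u)} kills w but not [w,w,w] = gamma + 3 eta w, it forces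
    gamma^2 = 0.  Since D_{(u,w),(1,u)} kills u and maps 1 to - eta w, it takes
    [1,u,u] = phi to - phi eta w, whereas the derivation rule asks for
    - eta [w,u,u] = - eta^2 w. *)
Lemma Jordan_plane_conditions (i j : 'I_n) : free b -> i != j ->
  ternary_Jordan (Vfgh f g h) -> gamma ^+ 2 = 0 /\ eta * (eta - phi) = 0.
Proof.
move=> free_b neq_ij jordan; have inj_e := plane_embed_inj free_b neq_ij.
pose o : F^o * (F^o * F^o) := (1, (0, 0)).
pose u : F^o * (F^o * F^o) := (0, (1, 0)).
pose w : F^o * (F^o * F^o) := (0, (0, 1)).
have rule x y z1 z2 z3 := @Jordan_sub _ _ _ _ _ _
  (fun x y z => @plane_prodE i j x y z neq_ij) x y z1 z2 z3 inj_e jordan.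
have eq0 (a c : F) : a = c -> c - a = 0 by move->; rewrite subrr.
have Duu z : mul_commutator plane_prod (u, u) (o, u) z =
    (phi * (3 * eta - phi) * z.2.1 - gamma * z.1,
     ((phi - 3 * eta) * z.1 + gamma * z.2.1, 0)).
  by congr (_, (_, _)); rewrite /= /dot /=; ring.
have Duw z : mul_commutator plane_prod (u, w) (o, u) z =
    (phi * eta * z.2.2, (0, - (eta * z.1))).
  by congr (_, (_, _)); rewrite /= /dot /=; ring.
split.
- have := rule (u, u) (o, u) w w w; rewrite !Duu => /(congr1 fst)/eq0 <-.
  by rewrite /= /dot /=; ring.
- have := rule (u, w) (o, u) o u u; rewrite !Duw => /(congr1 (fun t => t.2.2)).
  by move=> /eq0 E; rewrite -[RHS]oppr0 -E /= /dot /=; ring.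
Qed.

(** Put q = a1 x2 + a2 x1 and r = x1 x2 for the pair (a1 + x1 u, a2 + x2 u).  As
    3 = 1, its multiplication has equal diagonal entries and off-diagonal
    entries phi q + gamma r and q, so the commutator of two of these maps is
    the scalar gamma (r' q - r q'). *)
Lemma Jordan_line_char2 i : 2 = 0 :> F -> phi = eta ->
  (forall v, exists c, v = c *: tnth b i) -> ternary_Jordan (Vfgh f g h).
Proof.
move=> char2 eq_w line.
have surj (x : F^o * V) : exists x', x = line_embed (tnth b i) x'.
  by case: x => a v; have [c ->] := line v; exists (a, c).
apply: ternary_Jordan_scalar => [x y z|x y z|].
- have [[[x' ->] [y' ->]] [z' ->]] := (surj x, surj y, surj z).
  by rewrite !line_prodE; congr line_embed; congr pair => /=; ring.
- have [[[x' ->] [y' ->]] [z' ->]] := (surj x, surj y, surj z).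
  by rewrite !line_prodE; congr line_embed; congr pair => /=; ring.
move=> [x1 x2] [y1 y2].
have [[a1 ->] [a2 ->]] := (surj x1, surj x2).
have [[c1 ->] [c2 ->]] := (surj y1, surj y2).
pose q (a c : F^o * F^o) : F := a.1 * c.2 + c.1 * a.2.
pose r (a c : F^o * F^o) : F := a.2 * c.2.
pose k : F := gamma * (r c1 c2 * q a1 a2 - r a1 a2 * q c1 c2).
exists k => [|z].
  have -> : k + k = 2 * k by ring.
  by rewrite char2 mul0r.
have [z' ->] := surj z.
rewrite (Dmap_sub (line_prodE i) (a1, a2) (c1, c2)).
transitivity (line_embed (tnth b i) (k * z'.1, k * z'.2)); last first.
  by rewrite /line_embed /= -scalerA.
congr line_embed; congr pair.
  (* In any characteristic the two sides differ by a multiple of 2, and t is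
     the cofactor. *)
  pose t := - phi * (r c1 c2 * (phi * q a1 a2 + gamma * r a1 a2)
    - r a1 a2 * (phi * q c1 c2 + gamma * r c1 c2)) * z'.2.
  transitivity (k * z'.1 + 2 * t); last by rewrite char2 mul0r addr0.
  by rewrite /t /k /q /r /= -eq_w; ring.
pose t := - phi * (r a1 a2 * q c1 c2 - r c1 c2 * q a1 a2) * z'.1
  - k * z'.2.
transitivity (k * z'.2 + 2 * t); last by rewrite char2 mul0r addr0.
by rewrite /t /k /q /r /= -eq_w; ring.
Qed.

End CoordinateProducts.

(** * The other Jordan cases *)

Section Sufficiency.
Variables (F : fieldType) (V : vectType F).
Variables (f : {symmetric V}) (g : trilinear_map V F^o) (h : {symmetric V}).

Lemma form_sym (e : {symmetric V}) v w : e v w = e w v.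
Proof. by rewrite hermC expr0 mul1r. Qed.

Lemma Jordan_zero_forms :
  zero_bilinear f -> zero_trilinear g -> zero_bilinear h ->
  ternary_Jordan (Vfgh f g h).
Proof.
move=> f0 g0 h0; apply: ternary_Jordan_dual_numbers => -[a u] [c v] [d w].
by rewrite /= !f0 g0 !h0 !mulr0 !addr0.
Qed.

(** On a line the three terms with h add up to 3 h(u,u) x y z = 0, so the product
    is the one with zero forms. *)
Lemma Jordan_h_char3 (u : V) : 3 = 0 :> F -> (forall v, exists c, v = c *: u) ->
  zero_bilinear f -> zero_trilinear g -> ternary_Jordan (Vfgh f g h).
Proof.
move=> char3 line f0 g0; apply: ternary_Jordan_dual_numbers.
move=> [a v1] [c v2] [d v3].
have [[[x ->] [y ->]] [z ->]] := (line v1, line v2, line v3).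
rewrite /= !f0 g0 !mulr0 !addr0 !(linearZl_LR, linearZr_LR) /= !scalerA.
rewrite -!scalerDl; congr (_, _ *: _).
transitivity (c * d * x + a * d * y + a * c * z + 3 * (x * y * z * h u u)).
  by ring.
by rewrite char3 mul0r addr0.
Qed.

(** As 1 = 3, the term a1 a2 a3 can be counted three times, which makes the
    product the one of the symmetric form 1 (+) h. *)
Lemma Jordan_equal_forms_char2 : 2 = 0 :> F -> (forall v w, f v w = h v w) ->
  zero_trilinear g -> ternary_Jordan (Vfgh f g h).
Proof.
move=> char2 eq_fh g0.
pose B (x y : F^o * V) : F := x.1 * y.1 + h x.2 y.2.
apply: (ternary_Jordan_symmetric_form (B := B)) => [x y|z k x y|].
- by rewrite /B mulrC form_sym.
- by rewrite /B /= form_linearl /GRing.scale /=; ring.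
move=> [a u] [c v] [d w]; rewrite /= /B !eq_fh g0 /=; congr pair.
transitivity (a * c * d + a * h v w + c * h u w + d * h u v + 2 * (a * c * d)).
  by rewrite char2 mul0r.
by rewrite /= /GRing.scale /=; ring.
Qed.

End Sufficiency.

Lemma diagonal_forms_eq (F : fieldType) (V : vectType F) (n : nat)
    (b : n.-tuple V) (f h : {symmetric V}) :
  basis_of fullv b ->
  (forall i j, f (tnth b i) (tnth b j) = h (tnth b i) (tnth b j)) ->
  forall v w, f v w = h v w.
Proof.
move=> basis_b eq_b v w.
rewrite (coord_basis basis_b (memvf v)) (coord_basis basis_b (memvf w)).
rewrite !linear_sumlz; apply: eq_bigr => i _.
rewrite !linear_sumr; apply: eq_bigr => j _.
by rewrite !linearZl_LR !linearZr_LR /= -!tnth_nth eq_b.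
Qed.

(** * Weights *)

Section Weights.
Variables (F : fieldType) (V : vectType F) (n : nat) (b : n.-tuple V).
Hypotheses (n_gt0 : (0 < n)%N) (basis_b : basis_of fullv b).

Lemma bilinear_weight (f : {symmetric V}) :
  zero_bilinear f \/ standard_bilinear b f ->
  exists s : bool, (zero_bilinear f <-> ~~ s) /\
    forall i j, f (tnth b i) (tnth b j) = s%:R * (i == j)%:R.
Proof.
case=> [f0|fb]; [exists false|exists true].
  by split=> // i j; rewrite f0 mul0r.
split=> [|i j]; last by rewrite fb mul1r.
split=> // f0; have := fb (Ordinal n_gt0) (Ordinal n_gt0).
by rewrite f0 eqxx => /esym/eqP; rewrite oner_eq0.
Qed.

Lemma trilinear_weight (g : trilinear_map V F^o) :
  zero_trilinear g \/ standard_trilinear b g ->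
  exists s : bool, (zero_trilinear g <-> ~~ s) /\ forall i j k,
    g (tnth b i) (tnth b j) (tnth b k) = s%:R * ((i == j) && (j == k))%:R.
Proof.
case=> [g0|[_ gb]]; [exists false|exists true].
  by split=> // i j k; rewrite g0 mul0r.
split=> [|i j k]; last by rewrite gb mul1r.
pose i0 := Ordinal n_gt0; split=> // g0; have := gb i0 i0 i0.
by rewrite g0 eqxx => /esym/eqP; rewrite oner_eq0.
Qed.

Lemma line_of_basis i : n = 1%N -> forall v, exists c, v = c *: tnth b i.
Proof.
move=> n1 v; exists (coord b i v).
rewrite {1}(coord_basis basis_b (memvf v)) (bigD1 i) //= big1 => [|j].
  by rewrite addr0 -tnth_nth.
case/negP; apply/eqP/val_inj => /=.
by move: (ltn_ord i) (ltn_ord j); rewrite {2 4}n1 !ltnS !leqn0 => /eqP-> /eqP->.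
Qed.

End Weights.

(** If gamma = 1 then 2 = 0, the third equation becomes phi = eta, and a second
    basis vector is excluded.  If gamma = 0, then phi = 1, eta = 0 would give
    2 = 0 and 3 = 0; phi = 0, eta = 1 gives 6 = 0 and 9 = 0, and excludes a
    second basis vector; phi = eta = 1 gives 4 = 0.  The boolean line says that
    V has dimension 1. *)
Lemma weights_classification (F : fieldType) (s t r line : bool)
    (phi : F := s%:R) (gamma : F := t%:R) (eta : F := r%:R) :
  2 * gamma = 0 -> 6 * eta = 2 * phi -> gamma * (phi - 9 * eta) = 0 ->
  3 * (3 * eta - phi) * (eta - phi) = 0 ->
  (~~ line -> gamma ^+ 2 = 0 /\ eta * (eta - phi) = 0) ->
  [|| s, t | r] ->
  [\/ [/\ ~~ s, ~~ t, r, 3%N \in [pchar F] & line],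
      [/\ ~~ s, t, ~~ r, 2%N \in [pchar F] & line],
      [/\ s, ~~ t, r & 2%N \in [pchar F]] |
      [/\ s, t, r, 2%N \in [pchar F] & line]].
Proof.
rewrite !inE /= {}/phi {}/gamma {}/eta.
have contra : 1 = 0 :> F -> False by move/eqP; rewrite oner_eq0.
have bT : true%:R = 1 :> F by [].
have bF : false%:R = 0 :> F by [].
case: t; last case: s r => -[] //=; rewrite ?bT ?bF.
- rewrite !mulr1 !mul1r => char2 _ e _ plane _.
  have is_line : line.
    by case: line plane => // /(_ isT)[]; rewrite expr1n => /contra.
  have eq_sr : s = r.
    case: s r e {plane} => -[] //=; rewrite ?bT ?bF => e; case: contra.
      by rewrite -[RHS]e; ring.
    (* 1 = 10 - 9, and both 2 and 9 vanish. *)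
    transitivity (5 * 2 + 1 * (0 - 9 * 1) : F); first by ring.
    by rewrite e char2 !mulr0 addr0.
  rewrite -{}eq_sr is_line.
  by case: s {e plane}; [constructor 4 | constructor 2]; rewrite char2 eqxx.
- move=> _ e6 _ _ _ _; constructor 3; split=> //.
  have /eqP : (2 * 2 : F) = 0.
    by transitivity (6 * 1 - 2 * 1 : F); [ring | rewrite e6 subrr].
  by rewrite mulf_eq0 orbb.
- move=> _ e6 _ e3; case: contra.
  (* 1 = 3 - 2, and both 3 and 2 vanish. *)
  transitivity (3 * (3 * 0 - 1) * (0 - 1) - (2 * 1 - 6 * 0) : F); first by ring.
  by rewrite e3 e6 subrr subr0.
- move=> _ e6 _ e3 plane _; constructor 1.
  have char3 : 3 = 0 :> F.
    (* 3 = 9 - 6, and both 9 and 6 vanish. *)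
    transitivity (3 * (3 * 1 - 0) * (1 - 0) - (6 * 1 - 2 * 0) : F); first by ring.
    by rewrite e3 e6 subrr subr0.
  rewrite char3 eqxx; split=> //.
  by case: line plane => // /(_ isT)[_]; rewrite subr0 mul1r => /contra.
Qed.

(** * The classification *)

Theorem theorem1 (F : fieldType) (V : vectType F) (n : nat) (b : n.-tuple V)
    (f : {symmetric V}) (g : trilinear_map V F^o) (h : {symmetric V})
    (n_gt0 : (0 < n)%N) (basis_b : basis_of fullv b)
    (hf : zero_bilinear f \/ standard_bilinear b f)
    (hg : zero_trilinear g \/ standard_trilinear b g)
    (hh : zero_bilinear h \/ standard_bilinear b h) :
  (zero_bilinear f /\ zero_trilinear g /\ zero_bilinear h ->
     ternary_Jordan (Vfgh f g h)) /\
  (~ zero_bilinear f \/ ~ zero_trilinear g \/ ~ zero_bilinear h ->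
     (ternary_Jordan (Vfgh f g h) <->
        [\/ [/\ zero_bilinear f, zero_trilinear g, ~ zero_bilinear h,
                3%N \in [pchar F] & \dim (fullv : {vspace V}) = 1%N],
            [/\ zero_bilinear f, ~ zero_trilinear g, zero_bilinear h,
                2%N \in [pchar F] & \dim (fullv : {vspace V}) = 1%N],
            [/\ ~ zero_bilinear f, zero_trilinear g, ~ zero_bilinear h
              & 2%N \in [pchar F]] |
            [/\ ~ zero_bilinear f, ~ zero_trilinear g, ~ zero_bilinear h,
                2%N \in [pchar F] & \dim (fullv : {vspace V}) = 1%N]])).
Proof.
have [s [f0 f_diag]] := bilinear_weight n_gt0 hf.
have [t [g0 g_diag]] := trilinear_weight n_gt0 hg.
have [r [h0 h_diag]] := bilinear_weight n_gt0 hh.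
have not_iff (P : Prop) (c : bool) : (P <-> ~~ c) -> (~ P <-> c).
  by move->; case: c; split=> // nc; case: nc.
have [nf0 ng0 nh0] := And3 (not_iff _ _ f0) (not_iff _ _ g0) (not_iff _ _ h0).
pose i0 := Ordinal n_gt0; have free_b := basis_free basis_b.
have dimV := size_basis basis_b; have line := line_of_basis basis_b i0.
split=> [[zf [zg zh]]|some]; first exact: Jordan_zero_forms zf zg zh.
split=> [jordan|].
  have [e2 e6 e9 e3] :=
    Jordan_line_conditions f_diag g_diag h_diag i0 free_b jordan.
  have plane : n != 1%N -> (t%:R : F) ^+ 2 = 0 /\ (r%:R : F) * (r%:R - s%:R) = 0.
    move=> n_neq1; have n_gt1 : (1 < n)%N by rewrite ltn_neqAle eq_sym n_neq1.
    exact: (Jordan_plane_conditions f_diag g_diag h_diag (i := i0)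
      (j := Ordinal n_gt1)).
  have some_weight : [|| s, t | r].
    by case: some => [/nf0 ->|[/ng0 ->|/nh0 ->]]; rewrite ?orbT.
  case: (weights_classification e2 e6 e9 e3 plane some_weight).
  - by case=> /f0 ? /g0 ? /nh0 ? ? /eqP ?; constructor 1; rewrite dimV.
  - by case=> /f0 ? /ng0 ? /h0 ? ? /eqP ?; constructor 2; rewrite dimV.
  - by case=> /nf0 ? /g0 ? /nh0 ? ?; constructor 3.
  - by case=> /nf0 ? /ng0 ? /nh0 ? ? /eqP ?; constructor 4; rewrite dimV.
rewrite dimV !inE => -[].
- case=> zf zg _ /andP[_ /eqP char3] /line spans.
  exact: Jordan_h_char3 char3 spans zf zg.
- case=> /f0 s0 _ /h0 r0 /andP[_ /eqP char2] /line.
  apply: (Jordan_line_char2 f_diag g_diag h_diag) => //.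
  by rewrite (negPf s0) (negPf r0).
- case=> /nf0 s1 zg /nh0 r1 /andP[_ /eqP char2].
  apply: Jordan_equal_forms_char2 => //.
  by apply: (diagonal_forms_eq basis_b) => i j; rewrite f_diag h_diag s1 r1.
- case=> /nf0 s1 _ /nh0 r1 /andP[_ /eqP char2] /line.
  by apply: (Jordan_line_char2 f_diag g_diag h_diag); rewrite ?s1 ?r1.
Qed.
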